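(* Let $\eta_2=1$ and $\eta_d=\frac12$ for every integer $d\geq 3$. For each fixed integer $d\geq 2$, \[\frac{\eta_d}{d}\,k\log_2(k)(1+o(1))\leq N_{[d]}^{\mathrm{non}}(k)\leq k^{\frac{1}{2}\log_2(k)(1+o(1))},\] where the $o(1)$ terms tend to $0$ as $k\to\infty$.
   Context: Let $d\geq 2$ be an integer. A $[d]$-tree is a rooted tree in which the children of each vertex are linearly ordered from left to right and the number of children of each vertex is an element of $\{0,1,\dots,d\}$. Let $e$ be an edge in a $[d]$-tree that connects a vertex $u$ to one of its children $v$. If the total number of children of $u$ and $v$, excluding $v$ itself, is at most $d$, then contracting the edge $e$ is a legal contraction; in the contracted tree, the children of $v$ take the place of $v$ in the ordered list of children of $u$ (so children of $u$ to the left, respectively right, of $v$ remain to the left, respectively right, of the children of $v$). The result is again a $[d]$-tree. A $[d]$-tree $\mathcal T$ noncontiguously contains a $[d]$-tree $T$ if $T$ can be obtained from $\mathcal T$ by a (possibly empty) sequence of legal edge contractions. $N_{[d]}^{\mathrm{non}}(k)$ denotes the minimum number of vertices in a $[d]$-tree that noncontiguously contains every $[d]$-tree with $k$ vertices. *)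

(* Defs.v *)
From HB Require Import structures.
From Stdlib Require Import Relation_Operators.
From mathcomp Require Import all_boot all_order all_algebra.
From mathcomp Require Import all_classical all_reals all_analysis.

Set Implicit Arguments.
Unset Strict Implicit.
Unset Printing Implicit Defensive.

Import Order.TTheory GRing.Theory Num.Theory.

Local Open Scope nat_scope.

(* Finite rooted plane trees up to isomorphism: a vertex is the left-to-right
   list of the subtrees hanging from its children. *)
Inductive tree : Type := Node of seq tree.

Fixpoint nvertices (T : tree) : nat :=
  let: Node ts := T in (sumn (map nvertices ts)).+1.

Fixpoint is_dtree (d : nat) (T : tree) : bool :=
  let: Node ts := T in (size ts <= d) && all (is_dtree d) ts.

(* In [contract_here] the upper endpoint u of the contracted edge is the root
   and the lower endpoint v has list of children [vs]; [contract_below] moves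
   the contraction into one of the subtrees. *)
Inductive legal_contraction (d : nat) : tree -> tree -> Prop :=
| contract_here (l vs r : seq tree) :
    size l + size vs + size r <= d ->
    legal_contraction d (Node (l ++ Node vs :: r)) (Node (l ++ vs ++ r))
| contract_below (l r : seq tree) (T T' : tree) :
    legal_contraction d T T' ->
    legal_contraction d (Node (l ++ T :: r)) (Node (l ++ T' :: r)).

Definition noncontig_contains (d : nat) : tree -> tree -> Prop :=
  clos_refl_trans tree (legal_contraction d).

Definition noncontig_universal (d k : nat) (U : tree) : Prop :=
  is_dtree d U /\
  forall T : tree, is_dtree d T -> nvertices T = k -> noncontig_contains d U T.

(* Universal [d]-trees exist: the perfect d-ary tree of height h contains every
   [d]-tree with at most h + 1 vertices. *)
Fixpoint perfect_tree (d h : nat) : tree :=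
  if h is h'.+1 then Node (nseq d (perfect_tree d h')) else Node [::].

Lemma perfect_tree_is_dtree (d h : nat) : is_dtree d (perfect_tree d h).
Proof. by elim: h => //= h IHh; rewrite size_nseq leqnn all_nseq IHh orbT. Qed.

Lemma noncontig_contains_below (d : nat) (l r : seq tree) (T T' : tree) :
  noncontig_contains d T T' ->
  noncontig_contains d (Node (l ++ T :: r)) (Node (l ++ T' :: r)).
Proof.
elim=> [x y xy|x|x y z _ xy _ yz].
- exact/rt_step/contract_below.
- exact: rt_refl.
- exact: rt_trans xy yz.
Qed.

Lemma noncontig_contains_nseq (d : nat) (U : tree) (n : nat) (l ts : seq tree) :
  noncontig_contains d U (Node [::]) ->
  (forall i, i < size ts -> noncontig_contains d U (nth U ts i)) ->
  size ts <= n -> size l + n <= d ->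
  noncontig_contains d (Node (l ++ nseq n U)) (Node (l ++ ts)).
Proof.
move=> U0; elim: n l ts => [|n IHn] l [|t ts] Uts //= tsn lnd; try exact: rt_refl.
- apply: rt_trans (noncontig_contains_below _ _ U0) _.
  apply: rt_trans (IHn l [::] _ _ _) => //; last exact: leq_trans (leq_add _ _) lnd.
  apply/rt_step/(@contract_here d l [::]).
  by rewrite size_nseq addn0; apply: leq_trans (leq_add _ _) lnd.
- apply: rt_trans (noncontig_contains_below _ _ (Uts 0 _)) _ => //=.
  rewrite -!cat_rcons; apply: IHn => //; last by rewrite size_rcons addSnnS.
  by move=> i its; apply: (Uts i.+1).
Qed.

Lemma nvertices_gt0 (T : tree) : 0 < nvertices T.
Proof. by case: T. Qed.

Lemma perfect_tree_contains (d h : nat) (T : tree) :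
  is_dtree d T -> nvertices T <= h.+1 ->
  noncontig_contains d (perfect_tree d h) T.
Proof.
elim: h T => [|h IHh] [ts] /= /andP[tsd dts]; rewrite ltnS.
  case: ts tsd dts => [|t ts] _ _ /=; first by move=> _; exact: rt_refl.
  by rewrite leqn0 addn_eq0 eqn0Ngt nvertices_gt0.
move=> tsh; apply: (@noncontig_contains_nseq d _ d [::]) => // [|i its].
  exact: IHh.
apply: IHh; first exact: (all_nthP _ dts).
apply: leq_trans tsh; elim: ts i its {tsd dts} => [|t ts IHts] [|i] //= its.
  exact: leq_addr.
exact: leq_trans (IHts _ its) (leq_addl _ _).
Qed.

Lemma ex_noncontig_universal (d k : nat) :
  exists n : nat,
    `[< exists2 U : tree, noncontig_universal d k U & nvertices U = n >].
Proof.
exists (nvertices (perfect_tree d k)); apply/asboolP.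
exists (perfect_tree d k) => //; split; first exact: perfect_tree_is_dtree.
by move=> T dT Tk; apply: perfect_tree_contains; rewrite // Tk.
Qed.

Definition Nnon (d k : nat) : nat := ex_minn (ex_noncontig_universal d k).

Local Open Scope ring_scope.

Definition eta_const (R : realType) (d : nat) : R :=
  if (d == 2)%N then 1 else 2^-1.

Definition log2 (R : realType) (x : R) : R := ln x / ln 2.

(* Main.v *)
Require Import Defs.
From HB Require Import structures.
From Stdlib Require Import Relation_Operators.
From mathcomp Require Import all_boot all_order all_algebra.
From mathcomp Require Import all_classical all_reals all_analysis.
From mathcomp Require Import zify ring lra.

Import Order.TTheory GRing.Theory Num.Theory.
Import numFieldNormedType.Exports.

(** Contracting an edge from u to its child v removes v from the ancestor order
    of the tree and changes nothing else in that order.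

    Lower bound.  Let [width m T] be the largest number of pairwise incomparable
    vertices of [T] from each of which a downward path with [m] vertices starts.
    It cannot grow under contraction ([width_contains]).  In the decomposition of
    [T] into long paths (each vertex is joined to a tallest child) there are
    exactly [width m T] paths with at least [m] vertices, so the sum of
    [width m T] over m >= 1 is the number of vertices, of which one half is
    [sum_width_le_nvertices].  A comb with about k / m teeth of [m] vertices each
    has [k] vertices, so a universal tree [U] satisfies
    [width m U >= (k + 1) %/ (m + 1)] for every m ([width_universal]); the
    harmonic sum gives at least k (ln k - 2) vertices.  This is more than the
    claim, because eta_d / d <= 1 / 2 <= ln 2.

    Upper bound.  Follow in [T] a heavy path from the root: the subtrees that
    hang from it have at most half of the vertices ([heavy_child]).  Hence a long
    spine that carries on both sides of each vertex enough copies of a tree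
    universal for half the size is universal ([spine_contains]).  To keep the
    number of children at most [d], each vertex of the path in [T] gets a block
    of [d] spine vertices, one for each number l < d of copies on the left,
    balanced by d - 1 - l copies on the right; one of them fits and the others
    are contracted away.  Doubling the size thus multiplies the number of
    vertices by at most d^2 times the size, and after log2 k doublings the
    product of the sizes is k to the power (1 / 2) log2 k, while the factors d^2
    only contribute to the error term. *)

Local Open Scope nat_scope.

(** * Structural induction *)

Lemma tree_nested_ind (P : tree -> Prop) :
  (forall ts, (forall i, i < size ts -> P (nth (Node [::]) ts i)) ->
    P (Node ts)) ->
  forall T, P T.
Proof.
move=> PN T; have [n] := ubnP (nvertices T); elim: n T => // n IHn [ts] /= tsn.
apply: PN => i its; apply: IHn; move: tsn; rewrite ltnS; apply: leq_trans.
rewrite ltnS; elim: ts i its => //= t ts IHts [|i] its; first exact: leq_addr.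
exact: leq_trans (IHts _ its) (leq_addl _ _).
Qed.

Lemma is_dtree_widen {d e T} : d <= e -> is_dtree d T -> is_dtree e T.
Proof.
move=> de; elim/tree_nested_ind: T => ts IH /= /andP[tsd dts].
rewrite (leq_trans tsd de); apply/(all_nthP (Node [::])) => i its.
by apply: IH => //; apply: (all_nthP _ dts).
Qed.

(** * Lower bound *)

Fixpoint height (T : tree) : nat :=
  let: Node ts := T in (foldr maxn 0 (map height ts)).+1.

(** The largest antichain of vertices of height at least [m]: either the root
    alone, or a union of antichains of the subtrees. *)
Fixpoint width (m : nat) (T : tree) : nat :=
  let: Node ts := T in
  maxn (m <= height (Node ts)) (sumn (map (width m) ts)).

Lemma foldr_maxn_cat (s1 s2 : seq nat) :
  foldr maxn 0 (s1 ++ s2) = maxn (foldr maxn 0 s1) (foldr maxn 0 s2).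
Proof. by elim: s1 => [|x s1 IH] /=; rewrite ?max0n // IH maxnA. Qed.

Lemma width_gt0 (m : nat) (T : tree) : m <= height T -> 0 < width m T.
Proof. by case: T => ts; rewrite [width _ _]/= => ->; rewrite leq_max. Qed.

Lemma sum_width_children_gt0 (m : nat) (ts : seq tree) :
  0 < m -> m < height (Node ts) -> 0 < sumn (map (width m) ts).
Proof.
move=> m0 /=; rewrite ltnS; elim: ts => [|t ts IH] /=; first by rewrite leqn0 eqn0Ngt m0.
by rewrite leq_max addn_gt0 => /orP[/width_gt0 -> //|/IH ->]; rewrite orbT.
Qed.

(** The root contributes only when the subtrees contribute nothing, that is, when
    [m] exceeds the heights of all the children; so it extends one long path by
    one vertex. *)
Lemma width_node_le (m : nat) (ts : seq tree) : 0 < m ->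
  width m (Node ts) <= sumn (map (width m) ts) + (m == height (Node ts)).
Proof.
move=> m0; have /= := sum_width_children_gt0 m ts m0.
case: ltngtP => /= mh; lia.
Qed.

(** By the previous lemma each vertex adds at most one to the total, at the single
    value of [m] equal to its height. *)
Lemma sum_width_le_nvertices (M : nat) (T : tree) :
  \sum_(1 <= m < M) width m T <= nvertices T.
Proof.
elim/tree_nested_ind: T => ts IH.
apply: leq_trans
  (_ : \sum_(1 <= m < M) (sumn (map (width m) ts) + (m == height (Node ts)))
     <= _).
  rewrite big_nat_cond [leqRHS]big_nat_cond; apply: leq_sum => m.
  by rewrite andbT => /andP[m0 _]; apply: width_node_le.
rewrite big_split -[nvertices _]/((sumn (map nvertices ts)).+1) -[leqRHS]addn1.
apply: leq_add.
  elim: ts IH => [|t ts IHts] IH /=; first by rewrite big1.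
  rewrite big_split /=; apply: leq_add; first exact: (IH 0).
  by apply: IHts => i its; apply: (IH i.+1).
rewrite -big_mkcond /= sum1_count -/(count_mem _ _).
by rewrite count_uniq_mem ?iota_uniq// leq_b1.
Qed.

Lemma height_contraction (d : nat) (T T' : tree) :
  legal_contraction d T T' -> height T' <= height T.
Proof.
elim=> [l vs r _|l r {}T {}T' _ IH] /=; rewrite !map_cat !foldr_maxn_cat /=; lia.
Qed.

(** The children of the contracted vertex already counted in the width of the
    subtree that it roots. *)
Lemma width_contraction (d m : nat) (T T' : tree) :
  legal_contraction d T T' -> width m T' <= width m T.
Proof.
have widthE ts : width m (Node ts)
  = maxn (m <= height (Node ts)) (sumn (map (width m) ts)) by [].
move=> TT'; elim: (TT') => [l vs r lvr|l r S S' SS' IH].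
  have := height_contraction _ _ _ (@contract_here d l vs r lvr).
  rewrite !widthE; move: (height _) (height _) => a b ab.
  rewrite !map_cat !sumn_cat map_cons widthE /=; lia.
have := height_contraction _ _ _ (@contract_below d l r S S' SS').
rewrite !widthE; move: (height _) (height _) => a b ab.
rewrite !map_cat !sumn_cat /=; lia.
Qed.

Lemma width_contains (d m : nat) (T T' : tree) :
  noncontig_contains d T T' -> width m T' <= width m T.
Proof.
elim=> [{}T {}T' /width_contraction//|//|x y z _ xy _ yz].
exact: leq_trans yz xy.
Qed.

Definition path_tree (n : nat) : tree := iter n (fun T => Node [:: T]) (Node [::]).

(** A binary spine with [b] teeth, each a path with [m] vertices; the spine ends
    in a path that serves as one more tooth and absorbs the vertices left over. *)
Definition comb (m b e : nat) : tree :=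
  iter b (fun T => Node [:: path_tree m.-1; T]) (path_tree e).

Lemma nvertices_path (n : nat) : nvertices (path_tree n) = n.+1.
Proof. by elim: n => //= n ->; rewrite addn0. Qed.

Lemma height_path (n : nat) : height (path_tree n) = n.+1.
Proof. by elim: n => //= n ->; rewrite maxn0. Qed.

Lemma path_is_dtree (n : nat) : is_dtree 2 (path_tree n).
Proof. by elim: n => //= n ->. Qed.

Lemma comb_is_dtree (m b e : nat) : is_dtree 2 (comb m b e).
Proof. by elim: b => [|b IH] /=; rewrite path_is_dtree ?IH. Qed.

Lemma nvertices_comb (m b e : nat) : 0 < m ->
  nvertices (comb m b e) = b * m.+1 + e.+1.
Proof.
move=> m0; elim: b => [|b /= ->]; first exact: nvertices_path.
rewrite nvertices_path; lia.
Qed.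

Lemma width_comb (m b e : nat) : 0 < m -> m <= e.+1 ->
  b < width m (comb m b e).
Proof.
move=> m0 me; elim: b => [|b IH]; first by rewrite width_gt0 ?height_path.
(* The first tooth and the rest of the comb are the two subtrees of the root. *)
apply: leq_trans (leq_maxr _ _).
rewrite -[sumn _]/(width m (path_tree m.-1) + (width m (comb m b e) + 0)).
have : 0 < width m (path_tree m.-1) by rewrite width_gt0// height_path prednK.
lia.
Qed.

(** The comb with [k.+1 %/ m.+1] teeth fits in [k] vertices: every tooth takes its
    [m] vertices and one spine vertex, except the last, which needs no spine
    vertex. *)
Lemma width_universal (d k m : nat) (U : tree) : 2 <= d -> 0 < m ->
  noncontig_universal d k U -> k.+1 %/ m.+1 <= width m U.
Proof.
move=> d2 m0 [_ Uk]; case E: (k.+1 %/ m.+1) => [//|b].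
(* [b] is the number of teeth other than the end of the spine. *)
have := leq_trunc_div k.+1 m.+1; rewrite E => bk.
pose e := k.-1 - b * m.+1.
apply: leq_trans (width_comb m b e m0 _) (width_contains _ _ _ _ (Uk _ _ _)).
- rewrite /e; nia.
- exact: is_dtree_widen d2 (comb_is_dtree _ _ _).
- by rewrite nvertices_comb// /e; nia.
Qed.

Lemma Nnon_ge_sum (d k : nat) : 2 <= d ->
  \sum_(1 <= m < k.+1) k.+1 %/ m.+1 <= Nnon d k.
Proof.
move=> d2; rewrite /Nnon; case: ex_minnP => n /asboolP[U Uk <-] _.
apply: leq_trans (sum_width_le_nvertices k.+1 U).
rewrite big_nat_cond [leqRHS]big_nat_cond; apply: leq_sum => m.
by rewrite andbT => /andP[m0 _]; apply: width_universal Uk.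
Qed.

(** * Upper bound *)

(** The copies of [V] are used from left to right; a superfluous copy is shrunk to
    a leaf, and contracting a leaf is always legal. *)
Lemma contains_nseq (d n : nat) (V : tree) (l ts r : seq tree) :
  noncontig_contains d V (Node [::]) ->
  (forall i, i < size ts -> noncontig_contains d V (nth V ts i)) ->
  size ts <= n -> size l + n + size r <= d ->
  noncontig_contains d (Node (l ++ nseq n V ++ r)) (Node (l ++ ts ++ r)).
Proof.
move=> V0; elim: n l ts => [|n IHn] l [|t ts] Vts //= tsn lnr; try exact: rt_refl.
- apply: rt_trans (noncontig_contains_below _ _ V0) _.
  apply: rt_trans (IHn l [::] _ _ _) => //; last by lia.
  apply/rt_step/(@contract_here d l [::]).
  by rewrite size_cat size_nseq /=; lia.
- apply: rt_trans (noncontig_contains_below _ _ (Vts 0 _)) _ => //=.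
  rewrite -!cat_rcons; apply: IHn => //; last by rewrite size_rcons; lia.
  by move=> i its; apply: (Vts i.+1).
Qed.

Lemma contains_leaf {d : nat} {T : tree} :
  is_dtree d T -> noncontig_contains d T (Node [::]).
Proof.
elim/tree_nested_ind: T => ts; elim: ts => [|t ts IHts] IH /=; first by move=> _; apply: rt_refl.
move=> /and3P[tsd dt dts].
apply: rt_trans (@noncontig_contains_below d [::] ts t (Node [::]) (IH 0 isT dt)) _.
apply: rt_trans (rt_step _ _ _ _ (@contract_here d [::] [::] ts (ltnW tsd))) _.
apply: IHts => /=; last by rewrite dts (ltnW tsd).
by move=> i its; apply: (IH i.+1).
Qed.

Lemma contains_only_child (d : nat) (T : tree) :
  is_dtree d T -> noncontig_contains d (Node [:: T]) T.
Proof.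
case: T => vs /= /andP[vsd _]; apply/rt_step.
by have := @contract_here d [::] vs [::]; rewrite cats0 /= addn0; apply.
Qed.

Definition spine_vertex (d : nat) (V : tree) (l : nat) (S : tree) : tree :=
  Node (nseq l V ++ S :: nseq (d.-1 - l) V).

(** The split of the [d.-1] side copies that fits the tree to be embedded is not
    known in advance, so a block offers every split once. *)
Definition spine_block (d : nat) (V S : tree) : tree :=
  foldr (spine_vertex d V) S (iota 0 d).

Definition spine (d n : nat) (V : tree) : tree :=
  iter n (spine_block d V) (Node [::]).

(** Universal for fewer than [2 ^ t] vertices; the spine has one block for each
    vertex that a path in such a tree may have. *)
Fixpoint universal_tree (d t : nat) : tree :=
  if t is t'.+1 then spine d (2 ^ t'.+1).-1 (universal_tree d t') else Node [::].



Lemma le_sumn (s : seq nat) : all (fun x => x <= sumn s) s.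
Proof.
elim: s => //= x s IH; rewrite leq_addr /=; apply: sub_all IH => y /= ys.
exact: leq_trans ys (leq_addl _ _).
Qed.

Definition small_dtree (d h : nat) (T : tree) : bool :=
  is_dtree d T && (nvertices T <= h).

(** At most one child can have more than [h] of at most [2h] vertices; if there is
    none, any child will do. *)
Lemma heavy_child (h : nat) (ts : seq tree) :
  0 < size ts -> sumn (map nvertices ts) <= h.*2 ->
  exists l t r, ts = l ++ t :: r /\ all (fun T => nvertices T <= h) (l ++ r).
Proof.
have small_of_sum s : sumn (map nvertices s) <= h ->
    all (fun T => nvertices T <= h) s.
  move=> sh; have := le_sumn (map nvertices s); rewrite all_map.
  by apply: sub_all => T /= /leq_trans; apply.
have [|] := boolP (has (fun T => h < nvertices T) ts).
  move=> /split_find; move: (take _ _) (drop _ _) => l0 r0 tsE _; case: tsE => t l r ht _.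
  rewrite cat_rcons map_cat sumn_cat /= => lrh; exists l, t, r; split=> //.
  by apply: small_of_sum; rewrite map_cat sumn_cat; lia.
case: ts => // t ts; rewrite -all_predC => tsh _ _; exists [::], t, ts; split=> //=.
by move: tsh => /= /andP[_]; apply: sub_all => T /=; rewrite -leqNgt.
Qed.

Section Spine.
Variables (d : nat) (V : tree) (h : nat).
Hypotheses (d_gt0 : 0 < d) (V_dtree : is_dtree d V).
Hypothesis V_universal :
  forall T, is_dtree d T -> nvertices T <= h -> noncontig_contains d V T.

Lemma small_nth (s : seq tree) (i : nat) : all (small_dtree d h) s -> i < size s ->
  noncontig_contains d V (nth V s i).
Proof.
move=> /all_nthP ss its; have /andP[dT Th] := ss V i its.
exact: V_universal.
Qed.

Lemma spine_vertex_contains (l : nat) (S S' : tree) (ls rs : seq tree) :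
  l < d -> noncontig_contains d S S' ->
  all (small_dtree d h) ls -> all (small_dtree d h) rs -> size ls <= l -> size rs <= d.-1 - l ->
  noncontig_contains d (spine_vertex d V l S) (Node (ls ++ S' :: rs)).
Proof.
move=> ld SS' sls srs lsl rsr; have V0 := contains_leaf V_dtree.
apply: rt_trans (noncontig_contains_below _ _ SS') _.
have := @contains_nseq d l V [::] ls (S' :: nseq (d.-1 - l) V) V0.
move=> /(_ (fun i => small_nth ls i sls) lsl) /=; rewrite size_nseq => H.
apply: rt_trans (H _) _; first by lia.
have := @contains_nseq d (d.-1 - l) V (rcons ls S') rs [::] V0.
move=> /(_ (fun i => small_nth rs i srs) rsr) /=.
rewrite !cats0 !cat_rcons size_rcons; apply; lia.
Qed.

(** With all its side copies removed a spine vertex has one child, and the edge to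
    an only child can always be contracted. *)
Lemma spine_vertex_contains_below (l : nat) (S : tree) :
  l < d -> is_dtree d S -> noncontig_contains d (spine_vertex d V l S) S.
Proof.
move=> ld dS; apply: rt_trans (contains_only_child _ _ dS).
exact: (@spine_vertex_contains l S S [::] [::] ld (rt_refl _ _ _)).
Qed.

Lemma spine_vertex_is_dtree (l : nat) (S : tree) :
  l < d -> is_dtree d S -> is_dtree d (spine_vertex d V l S).
Proof.
move=> ld dS; rewrite /= all_cat size_cat /= dS !all_nseq V_dtree !orbT !size_nseq.
by rewrite !andbT; lia.
Qed.

Lemma spine_segment_is_dtree (s : seq nat) (S : tree) :
  all (fun l => l < d) s -> is_dtree d S ->
  is_dtree d (foldr (spine_vertex d V) S s).
Proof.
move=> + dS; elim: s => //= l s IH /andP[ld sd].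
by apply: spine_vertex_is_dtree => //; apply: IH.
Qed.

Lemma spine_segment_contains_below (s : seq nat) (S : tree) :
  all (fun l => l < d) s -> is_dtree d S ->
  noncontig_contains d (foldr (spine_vertex d V) S s) S.
Proof.
move=> + dS; elim: s => [|l s IH] /=; first by move=> _; apply: rt_refl.
move=> /andP[ld sd]; apply: rt_trans (IH sd).
by apply: spine_vertex_contains_below => //; apply: spine_segment_is_dtree.
Qed.

(** The spine vertex with [size ls] copies on the left is the one that is kept;
    as [size rs <= d.-1 - size ls], it has enough copies on the right. *)
Lemma spine_block_contains (S S' : tree) (ls rs : seq tree) :
  is_dtree d S -> noncontig_contains d S S' ->
  all (small_dtree d h) ls -> all (small_dtree d h) rs -> size ls + size rs < d ->
  noncontig_contains d (spine_block d V S) (Node (ls ++ S' :: rs)).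
Proof.
move=> dS SS' sls srs lrd; have iotad m n : m + n <= d -> all (fun l => l < d) (iota m n).
  by move=> mn; apply/allP => x; rewrite mem_iota; lia.
rewrite /spine_block; (* Cut the block just above the spine vertex that is kept. *)
have -> : d = size ls + (d - size ls).-1.+1 by lia.
rewrite iotaD foldr_cat /= -!/(spine_vertex _ _ _ _).
have -> : size ls + (d - size ls).-1.+1 = d by lia.
set S1 := foldr _ S _.
have dS1 : is_dtree d S1 by apply: spine_segment_is_dtree => //; apply: iotad; lia.
apply: rt_trans (spine_segment_contains_below _ _ _ _) _.
- by apply: iotad; lia.
- by apply: spine_vertex_is_dtree; lia.
apply: spine_vertex_contains => //; try lia.
apply: rt_trans SS'; apply: spine_segment_contains_below => //.
by apply: iotad; lia.
Qed.

Lemma iota_ltn : all (fun l => l < d) (iota 0 d).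
Proof. by apply/allP => x; rewrite mem_iota. Qed.

Lemma spine_is_dtree (n : nat) : is_dtree d (spine d n V).
Proof. by elim: n => //= n IH; apply: spine_segment_is_dtree iota_ltn IH. Qed.

(** Each block of the spine hosts one vertex of the heavy path of [T], and the
    light subtrees of that vertex are found in the copies of [V]. *)
Lemma spine_contains (n : nat) (T : tree) :
  is_dtree d T -> nvertices T <= n -> nvertices T <= h.*2.+1 ->
  noncontig_contains d (spine d n V) T.
Proof.
elim: n T => [|n IHn] [ts]; first by rewrite leqn0 eqn0Ngt nvertices_gt0.
case: (posnP (size ts)) => [/size0nil -> _ _ _|ts0].
  exact: contains_leaf (spine_is_dtree n.+1).
move=> /[dup] dT /= /andP[tsd dts]; rewrite !ltnS => tsn tsh.
have [l [t [r [tsE lrh]]]] := heavy_child h ts ts0 tsh.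
move: dT tsd dts tsn tsh; rewrite {}tsE => dT.
rewrite size_cat /= map_cat sumn_cat all_cat /= => lrd /and3P[dl dt dr] lrn ltrh.
move: lrh; rewrite all_cat => /andP[lh rh].
apply: spine_block_contains.
- exact: spine_is_dtree.
- by apply: IHn => //; lia.
- by rewrite all_predI dl.
- by rewrite all_predI dr.
- by lia.
Qed.

End Spine.

Lemma nvertices_spine_segment (d : nat) (V S : tree) (s : seq nat) :
  0 < d -> all (fun l => l < d) s ->
  nvertices (foldr (spine_vertex d V) S s)
  = size s * (d.-1 * nvertices V).+1 + nvertices S.
Proof.
move=> d0; elim: s => //= l s IH /andP[ld /IH E].
rewrite map_cat sumn_cat /= E !map_nseq !sumn_nseq; nia.
Qed.

Lemma nvertices_spine (d n : nat) (V : tree) : 0 < d ->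
  nvertices (spine d n V) = n * (d * (d.-1 * nvertices V).+1) + 1.
Proof.
move=> d0; elim: n => //= n IH.
rewrite nvertices_spine_segment ?iota_ltn// size_iota IH; lia.
Qed.

Lemma universal_tree_is_dtree (d t : nat) : 0 < d -> is_dtree d (universal_tree d t).
Proof. by move=> d0; elim: t => // t IH; apply: spine_is_dtree. Qed.

Lemma universal_tree_contains (d t : nat) (T : tree) : 0 < d ->
  is_dtree d T -> nvertices T < 2 ^ t -> noncontig_contains d (universal_tree d t) T.
Proof.
move=> d0; elim: t T => [|t IH] T dT; first by rewrite ltnS leqn0 eqn0Ngt nvertices_gt0.
rewrite expnS => Tt; have t0 : 0 < 2 ^ t by rewrite expn_gt0.
apply: (@spine_contains d (universal_tree d t) (2 ^ t).-1) => //.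
- exact: universal_tree_is_dtree.
- by move=> S dS St; apply: IH => //; lia.
- by rewrite expnS; lia.
- by lia.
Qed.

(** The factors [2 ^ i] of the steps multiply to [2 ^ 'C(t.+1, 2)]; the factor
    [d * d] of each step is at most [2 ^ (2 * d)]. *)
Lemma nvertices_universal_tree (d t : nat) : 0 < d ->
  nvertices (universal_tree d t) <= 2 ^ ('C(t.+1, 2) + (2 * d) * t).
Proof.
move=> d0; elim: t => [|t IH]; first by rewrite muln0.
apply: (@leq_trans (2 ^ t.+1 * (d * d) * nvertices (universal_tree d t))).
  rewrite [universal_tree d t.+1]/= nvertices_spine//.
  have := nvertices_gt0 (universal_tree d t).
  move: (nvertices _) (2 ^ t.+1) (expn_gt0 2 t.+1) => v p /= p0 v0.
  rewrite -(prednK p0) -(prednK d0) /= -(prednK v0); nia.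
rewrite binS bin1 mulnS.
have -> : 'C(t.+1, 2) + t.+1 + (2 * d + 2 * d * t)
  = t.+1 + (d + d) + ('C(t.+1, 2) + 2 * d * t) by lia.
have d2 : d <= 2 ^ d by rewrite ltnW// ltn_expl.
by rewrite expnD leq_mul// expnD leq_mul// expnD leq_mul.
Qed.

Lemma Nnon_le_pow2 (d t k : nat) : 0 < d -> k < 2 ^ t ->
  Nnon d k <= 2 ^ ('C(t.+1, 2) + (2 * d) * t).
Proof.
move=> d0 kt; rewrite /Nnon; case: ex_minnP => n _ nmin.
apply: leq_trans (nvertices_universal_tree d t d0); apply: nmin.
apply/asboolP; exists (universal_tree d t) => //; split.
  exact: universal_tree_is_dtree.
by move=> T dT Tk; apply: universal_tree_contains => //; rewrite Tk.
Qed.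

Lemma Nnon1 (d : nat) : Nnon d 1 <= 1.
Proof.
rewrite /Nnon; case: ex_minnP => n _; apply; apply/asboolP.
exists (Node [::]) => //; split=> // -[[|t ts] _ /=]; first by move=> _; apply: rt_refl.
by have := nvertices_gt0 t; lia.
Qed.

(** * Asymptotics *)

Local Open Scope classical_set_scope.
Local Open Scope ring_scope.

Lemma ln2_bounds (R : realType) : 1 / 2 <= ln (2 : R) <= 1.
Proof.
apply/andP; split; last first.
  have -> : (2 : R) = 1 + 1 by lra.
  by apply: le_ln1Dx; lra.
have : ln (1 + - (1 / 2) : R) <= - (1 / 2) by apply: le_ln1Dx; lra.
have -> : 1 + - (1 / 2) = (2 : R)^-1 by lra.
rewrite lnV ?posrE//; lra.
Qed.

(** Induction with the step ln (n + 3) - ln (n + 2) = ln (1 + 1 / (n + 2))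
    <= 1 / (n + 2). *)
Lemma harmonic_ge_ln (R : realType) (n : nat) :
  ln (n.+2%:R : R) - ln 2 <= \sum_(1 <= m < n.+1) m.+1%:R^-1.
Proof.
elim: n => [|n IH]; first by rewrite big_nil subrr.
rewrite big_nat_recr//=.
have n0 : 0 < (n.+2%:R : R) by rewrite ltr0n.
have : ln (1 + n.+2%:R^-1 : R) <= n.+2%:R^-1.
  by apply/le_ln1Dx/(@lt_trans _ _ 0); rewrite ?ltrN10 ?invr_gt0.
have -> : 1 + n.+2%:R^-1 = n.+3%:R / n.+2%:R :> R.
  by rewrite -[n.+3]addn1 natrD mulrDl divff ?gt_eqF// mul1r.
rewrite ln_div ?posrE ?ltr0n// => step; apply: le_trans (lerD IH step).
by rewrite [leRHS]addrC addrA subrK.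
Qed.

Lemma Nnon_ge_ln (R : realType) (d k : nat) : (2 <= d)%N ->
  k%:R * (ln (k%:R : R) - 2) <= (Nnon d k)%:R.
Proof.
move=> d2; case: (posnP k) => [->|k0]; first by rewrite mul0r.
apply: le_trans (_ : (\sum_(1 <= m < k.+1) k.+1 %/ m.+1)%:R <= _); last first.
  by rewrite ler_nat Nnon_ge_sum.
rewrite natr_sum.
apply: le_trans (_ : \sum_(1 <= m < k.+1) (k%:R * m.+1%:R^-1 - 1) <= _); last first.
  apply: ler_sum => m _; rewrite lerBlDr ler_pdivrMr ?ltr0n//.
  (* k / (m + 1) <= floor ((k + 1) / (m + 1)) + 1 *)
  rewrite -[1]/(1%:R) -natrD -natrM ler_nat.
  have := ltn_ceil k.+1 (ltn0Sn m); rewrite addn1 => /ltnW; exact: leq_trans.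
rewrite big_split /= -mulr_sumr sumrN.
rewrite big_const_nat subn1 /= iter_addr_0 -[X in _ <= _ - X]mulr1 -mulrBr.
have k0' : 0 < (k%:R : R) by rewrite ltr0n.
rewrite ler_pM2l//.
have := harmonic_ge_ln R k; set S := \sum_(_ <= _ < _) _ => HS.
have : ln (k%:R : R) <= ln k.+2%:R by rewrite ler_ln ?posrE ?ltr0n// ler_nat; lia.
have /andP[_] := ln2_bounds R; lra.
Qed.

Lemma cst_div_ln_cvg0 (R : realType) (c : R) :
  (c / ln (k%:R : R)) @[k --> \oo] --> (0 : R).
Proof.
rewrite -[X in _ --> X](mulr0 c); apply: cvgMr.
apply/gtr0_cvgV0.
  near=> k; apply: ln_gt0; rewrite ltr1n; near: k; exact: nbhs_infty_gt.
apply/cvgryPge => A; near=> k.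
have k0 : 0 < (k%:R : R) by rewrite ltr0n; near: k; exact: nbhs_infty_gt.
rewrite -ler_expR lnK ?posrE//; near: k; exact: nbhs_infty_ger.
Unshelve. all: by end_near. Qed.

Lemma eta_div_le (R : realType) (d : nat) : (2 <= d)%N ->
  0 <= eta_const R d / d%:R <= 1 / 2.
Proof.
move=> d2; have d0 : 0 < (d%:R : R) by rewrite ltr0n; lia.
have d2' : 2 <= (d%:R : R) by rewrite ler_nat.
by rewrite /eta_const; case: ifP => _; rewrite divr_ge0 ?ler_pdivrMr//; lra.
Qed.

Lemma Nnon_lower (R : realType) (d k : nat) : (2 <= d)%N -> (1 <= k)%N ->
  eta_const R d / d%:R * k%:R * log2 (k%:R : R) * (1 + - 2 / ln k%:R)
    <= (Nnon d k)%:R.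
Proof.
move=> d2 k1; have KN := Nnon_ge_ln R d k d2.
have /andP[c0 c1] := eta_div_le R d d2; have /andP[D0 _] := ln2_bounds R.
have k0 : 0 <= (k%:R : R) by [].
have N0 : 0 <= ((Nnon d k)%:R : R) by [].
have l0 : 0 <= ln (k%:R : R) by rewrite ln_ge0// ler1n.
rewrite /log2.
move: KN c0 c1 D0 k0 N0 l0.
move: (eta_const R d / _) (ln (k%:R : R)) (ln (2 : R)) => c l D.
move: ((Nnon d k)%:R : R) (k%:R : R) => N K.
move=> KN c0 c1 D0 K0 N0 l0.
(* [l = 0] is the case of a single vertex, where [1 / ln k] is a default value. *)
have [->|l_neq0] := eqVneq l 0; first by rewrite mul0r mulr0 mul0r.
have -> : c * K * (l / D) * (1 + - 2 / l) = c / D * (K * (l - 2)).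
  by field; rewrite l_neq0/=; lra.
have cD0 : 0 <= c / D by rewrite divr_ge0//; lra.
have cD1 : c / D <= 1 by rewrite ler_pdivrMr; lra.
nra.
Qed.

(** Write L for log2 k and a for its integer part.  The exponent of 2 is
    (a + 2)(a + 1) / 2 + 2d (a + 1), which for 1 <= L is at most
    (L^2 + (5 + 8d) L) / 2; the linear term is the error term. *)
Lemma Nnon_upper (R : realType) (d k : nat) : (0 < d)%N -> (1 <= k)%N ->
  (Nnon d k)%:R <=
  (k%:R : R) `^ (2^-1 * log2 (k%:R : R) * (1 + (5 + 8 * d%:R) * ln 2 / ln k%:R)).
Proof.
move=> d0; rewrite leq_eqVlt => /predU1P[<-|k1].
  by rewrite powR1 -[1]/(1%:R) ler_nat Nnon1.
have k0 : 0 < (k%:R : R) by rewrite ltr0n; lia.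
set a := trunc_log 2 k; have ka : (k < 2 ^ a.+1)%N by rewrite trunc_log_ltn.
have ak : (2 ^ a <= k)%N by rewrite trunc_logP//; lia.
apply: le_trans (_ : (2 ^ ('C(a.+2, 2) + 2 * d * a.+1))%:R <= _).
  by rewrite ler_nat Nnon_le_pow2.
set e := (_ + _)%N.
have e2 : (2 * e = a.+2 * a.+1 + 4 * d * a.+1)%N.
  by rewrite mulnDr -(mul_bin_diag a.+2 1) bin1 -[a.+2.-1]/a.+1; lia.
have e2' : 2 * (e%:R : R) = (a%:R + 2) * (a%:R + 1) + 4 * d%:R * (a%:R + 1).
  have := congr1 (fun n => n%:R : R) e2.
  by rewrite natrD !natrM -[a.+2]addn2 -[a.+1]addn1 !natrD.
rewrite /powR gt_eqF// natrX -[X in X ^+ _]lnK ?posrE// -expRM_natl ler_expR.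
have /andP[D0 D1] := ln2_bounds R.
have lE : ln (k%:R : R) = log2 k%:R * ln 2 by rewrite /log2 divfK// gt_eqF//; lra.
have ln_pow n : (2 ^ n <= k)%N -> n%:R <= log2 (k%:R : R).
  move=> nk; rewrite /log2 ler_pdivlMr ?mulr_natl; last lra.
  rewrite -lnXn// ler_ln ?posrE ?exprn_gt0//.
  by rewrite -natrX ler_nat.
have La := ln_pow _ ak; have L1 := ln_pow 1%N k1; rewrite lE.
move: La L1 D0 e2' {lE ln_pow}.
move: (log2 _) (ln 2) (e%:R : R) => L D E La L1 D0 E2.
have -> : (2^-1 * L * (1 + (5 + 8 * d%:R) * D / (L * D)) * (L * D))
  = (2^-1 * (L * L + (5 + 8 * d%:R) * L)) * D by field; lra.
rewrite ler_pM2r; last lra.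
have a0 : 0 <= (a%:R : R) by [].
have d0' : 0 <= (d%:R : R) by [].
move: (a%:R) (d%:R) a0 d0' La E2 => A B A0 B0 La E2.
have -> : E = 2^-1 * ((A + 2) * (A + 1) + 4 * B * (A + 1)) by rewrite -E2; field.
rewrite ler_pM2l//.
nra.
Qed.

Theorem mainTheorem10 (R : realType) (d : nat) (hd : (2 <= d)%N) :
  exists o1 o2 : nat -> R,
    [/\ o1 k @[k --> \oo] --> (0 : R),
        o2 k @[k --> \oo] --> (0 : R)
      & forall k : nat, (1 <= k)%N ->
          eta_const R d / d%:R * k%:R * log2 (k%:R : R) * (1 + o1 k)
            <= (Nnon d k)%:R
          /\ (Nnon d k)%:R
            <= (k%:R : R) `^ (2^-1 * log2 (k%:R : R) * (1 + o2 k))].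
Proof.
exists (fun k => - 2 / ln k%:R), (fun k => (5 + 8 * d%:R) * ln 2 / ln k%:R).
split=> [||k k1]; [exact: cst_div_ln_cvg0..|].
split; first exact: Nnon_lower.
by apply: Nnon_upper => //; apply: leq_trans hd.
Qed.
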